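(* Let $f:\mathbb{N}\to\mathbb{C}$ be a multiplicative arithmetic function. For any natural number $n$, if $n=\prod_{i=1}^{s}p_i^{\alpha_i}$ is the prime factorization of $n$, then $$(f*\delta)(n)=(Id*f)(n)\sum_{i=1}^{s}\frac{(f*\delta)(p_i^{\alpha_i})}{(Id*f)(p_i^{\alpha_i})}.$$
   Context: An arithmetic function is a function from the positive integers to $\mathbb{C}$. An arithmetic function $f$ is multiplicative if $f(nm)=f(n)f(m)$ for every pair of coprime positive integers $n,m$. The arithmetic derivative $\delta$ is the function on the positive integers, with values in the nonnegative integers, determined by $\delta(p)=1$ for every prime $p$ and the Leibniz rule $\delta(ab)=\delta(a)b+a\delta(b)$ for all positive integers $a,b$; equivalently, $\delta(n)=n\sum_{i=1}^{s}\frac{\alpha_i}{p_i}$ if $n=\prod_{i=1}^{s}p_i^{\alpha_i}$ is the prime factorization of $n$ (with $p_1,\dots,p_s$ distinct primes and $\alpha_i\ge 1$). $Id$ is the function $Id(n)=n$ for all positive integers $n$. The Dirichlet convolution of arithmetic functions $f,g$ is $(f*g)(n)=\sum_{d\mid n}f(d)\,g(n/d)$, the sum being over all positive divisors $d$ of $n$.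
   Formalization: The formal theorem assumes that every denominator (Id*f)(p_i^{α_i}) occurring in the sum is nonzero; without this the right side is undefined, e.g. for f(n)=μ(n)n and n=2. *)

(* Defs.v *)
From mathcomp Require Import all_boot all_order all_algebra.
From mathcomp Require Import all_reals.
From mathcomp Require Import complex.
From mathcomp Require Import zify.

Set Implicit Arguments.
Unset Strict Implicit.
Unset Printing Implicit Defensive.

Import Order.TTheory GRing.Theory Num.Theory.
Local Open Scope ring_scope.

(* The complex numbers are R[i], with R the real numbers (any realType).
   An arithmetic function is encoded as a total function on nat, of which only
   the values at positive integers are meaningful: no definition below, used at
   a positive argument, looks at the value at 0. *)
Definition arithmetic_function (R : realType) := nat -> R[i].

(* The zero function is not excluded: f 1 = 1 is not required. *)
Definition multiplicative_arith (R : realType) (f : arithmetic_function R) :=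
  forall n m : nat, (0 < n)%N -> (0 < m)%N -> coprime n m ->
    f (n * m)%N = f n * f m.

Definition dirichlet_conv (R : realType) (f g : arithmetic_function R) :
    arithmetic_function R :=
  fun n => \sum_(d <- divisors n) f d * g (n %/ d)%N.

(* n * \sum_i alpha_i / p_i, computed in nat: each division n %/ p is exact.
   The lemmas below show that, on the positive integers, this is the only
   function that is 1 at the primes and satisfies the Leibniz rule. *)
Definition arith_deriv (n : nat) : nat :=
  (\sum_(p <- primes n) logn p n * (n %/ p))%N.

Lemma arith_deriv_prime (p : nat) : prime p -> arith_deriv p = 1%N.
Proof.
move=> pp; rewrite /arith_deriv primes_prime // big_seq1.
by rewrite logn_prime // eqxx mul1n divnn prime_gt0.
Qed.

Lemma arith_deriv_leibniz (a b : nat) : (0 < a)%N -> (0 < b)%N ->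
  arith_deriv (a * b) = (arith_deriv a * b + a * arith_deriv b)%N.
Proof.
have wide n m : (0 < n)%N -> (0 < m)%N ->
    arith_deriv n =
      (\sum_(p <- primes (n * m)) logn p n * (n %/ p))%N.
  move=> n0 m0; rewrite /arith_deriv.
  rewrite [RHS](bigID (fun p => p \in primes n)) /= [X in (_ + X)%N]big1 ?addn0.
    rewrite -[RHS]big_filter; apply: perm_big; apply: uniq_perm.
    - exact: primes_uniq.
    - by rewrite filter_uniq ?primes_uniq.
    by move=> p; rewrite mem_filter primesM //; case: (p \in primes n).
  by move=> p; rewrite -logn_gt0 -eqn0Ngt => /eqP ->.
move=> a0 b0; rewrite (wide a b) // (wide b a) // [(b * a)%N]mulnC.
rewrite big_distrl big_distrr -big_split /= /arith_deriv.
apply: eq_bigr => p _; rewrite lognM // mulnDl; congr (_ + _)%N.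
  have [pa|npa] := boolP (p %| a)%N; last first.
    by rewrite (lognE p a) (negbTE npa) !andbF.
  by rewrite -mulnA -divn_mulAC.
have [pb|npb] := boolP (p %| b)%N; last first.
  by rewrite (lognE p b) (negbTE npb) !andbF muln0.
by rewrite -muln_divA // mulnCA.
Qed.

Lemma arith_deriv_unique (d : nat -> nat) :
  (forall p, prime p -> d p = 1%N) ->
  (forall a b, (0 < a)%N -> (0 < b)%N ->
     d (a * b)%N = (d a * b + a * d b)%N) ->
  forall n, (0 < n)%N -> d n = arith_deriv n.
Proof.
move=> dp dM; elim/ltn_ind => n IH n0.
have [n1|n1] := leqP n 1.
  have -> : n = 1%N by apply/eqP; rewrite eqn_leq n1.
  have := dM 1%N 1%N isT isT; rewrite !mul1n muln1 /arith_deriv big_nil.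
  by move=> h; lia.
have pp := pdiv_prime n1; have q0 : (0 < n %/ pdiv n)%N.
  by rewrite divn_gt0 ?pdiv_leq ?pdiv_gt0.
rewrite -(divnK (pdiv_dvd n)) dM ?pdiv_gt0 // arith_deriv_leibniz ?pdiv_gt0 //.
by rewrite (dp _ pp) (arith_deriv_prime pp) IH // ltn_Pdiv // prime_gt1.
Qed.

Definition arith_delta (R : realType) : arithmetic_function R :=
  fun n => (arith_deriv n)%:R.

Definition arith_Id (R : realType) : arithmetic_function R := fun n => n%:R.

(* Main.v *)
Require Import Defs.
From mathcomp Require Import all_boot all_order all_algebra.
From mathcomp Require Import all_reals.
From mathcomp Require Import complex.

Import Order.TTheory GRing.Theory Num.Theory.
Local Open Scope ring_scope.

(** The convolution [f * Id], equal to [Id * f], is multiplicative because [f] and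
[Id] are.
The Leibniz rule makes [delta] a derivation twisted by [Id], namely
[delta (u * v) = delta u * Id v + Id u * delta v], and convolving with the
multiplicative [f] carries this over to coprime arguments: writing
[D = f * delta] and [E = f * Id], one gets
[D (a * b) = D a * E b + E a * D b] when [a] and [b] are coprime
([dirichlet_conv_delta_coprime]).
When [E] does not vanish this says that [D / E] is additive on coprime
products, like a logarithmic derivative, so that for pairwise coprime factors
[D / E] of the product is the sum of the [D / E] of the factors
([dirichlet_conv_delta_prod]).
Both coprime rules come from the bijection between divisors of [a * b] and
pairs made of a divisor of [a] and a divisor of [b] ([big_divisors_coprime]). *)

Lemma gcdn_mul_dvd_coprime (a b d e : nat) :
  coprime a b -> (d %| a)%N -> (e %| b)%N -> gcdn a (d * e) = d.
Proof.
by move=> ab da eb; rewrite Gauss_gcdl ?(coprime_dvdr eb) //; apply/gcdn_idPr.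
Qed.
Arguments gcdn_mul_dvd_coprime [a b d e].

Lemma dvdn_coprime_split (a b x : nat) :
  (0 < a)%N -> coprime a b -> (x %| a * b)%N ->
  exists d e, [/\ (d %| a)%N, (e %| b)%N & x = (d * e)%N].
Proof.
move=> a0 ab xab; have g0 : (0 < gcdn x a)%N by rewrite gcdn_gt0 a0 orbT.
exists (gcdn x a), (x %/ gcdn x a)%N; split; first exact: dvdn_gcdr.
  (* Once [gcdn x a] is cancelled, what is left of [x] is coprime to what is
     left of [a], hence must divide [b]. *)
  have co : coprime (x %/ gcdn x a) (a %/ gcdn x a).
    rewrite /coprime -(eqn_pmul2r g0) muln_gcdl mul1n.
    by rewrite !divnK ?dvdn_gcdl ?dvdn_gcdr.
  rewrite -(Gauss_dvdr _ co) -(dvdn_pmul2r g0) divnK ?dvdn_gcdl //.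
  by rewrite mulnAC divnK ?dvdn_gcdr.
by rewrite mulnC divnK ?dvdn_gcdl.
Qed.
Arguments dvdn_coprime_split [a b x].

(** Multiplication is a bijection from pairs of divisors of [a] and of [b] to
divisors of [a * b]: a gcd with [a] or with [b] recovers each component. *)
Lemma big_divisors_coprime (V : nmodType) (a b : nat) (F : nat -> V) :
  (0 < a)%N -> (0 < b)%N -> coprime a b ->
  \sum_(x <- divisors (a * b)) F x =
  \sum_(d <- divisors a) \sum_(e <- divisors b) F (d * e)%N.
Proof.
move=> a0 b0 ab; rewrite -(big_allpairs_dep (h := muln)).
apply: perm_big; apply: uniq_perm; first exact: divisors_uniq.
  apply: allpairs_uniq; try exact: divisors_uniq.
  move=> _ _ /allpairsP[[d e] /= [da eb ->]] /allpairsP[[d' e'] /= [da' eb' ->]].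
  move: da eb da' eb'; rewrite -!dvdn_divisors //= => da eb da' eb' eq_de.
  have ba : coprime b a by rewrite coprime_sym.
  congr pair.
    by rewrite -(gcdn_mul_dvd_coprime ab da eb) eq_de (gcdn_mul_dvd_coprime ab).
  rewrite -(gcdn_mul_dvd_coprime ba eb da) mulnC eq_de mulnC.
  by rewrite (gcdn_mul_dvd_coprime ba).
move=> x; rewrite -dvdn_divisors ?muln_gt0 ?a0 //.
apply/idP/allpairsP => [/(dvdn_coprime_split a0 ab)[d [e [da eb ->]]]|].
  by exists (d, e); rewrite -!dvdn_divisors.
by case=> -[d e] /= []; rewrite -!dvdn_divisors // => da eb ->; exact: dvdn_mul.
Qed.

Lemma dirichlet_convC (R : realType) (f g : arithmetic_function R) (n : nat) :
  (0 < n)%N -> dirichlet_conv f g n = dirichlet_conv g f n.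
Proof.
move=> n0; have divK d : d \in divisors n -> (n %/ (n %/ d))%N = d.
  by rewrite -dvdn_divisors // => dn; rewrite divnA // mulKn.
rewrite /dirichlet_conv.
transitivity (\sum_(d <- [seq (n %/ d)%N | d <- divisors n])
                 f d * g (n %/ d)%N).
  apply: perm_big; apply: uniq_perm; first exact: divisors_uniq.
    rewrite map_inj_in_uniq ?divisors_uniq // => d e dn en /(congr1 (divn n)).
    by rewrite !divK.
  have dvd d : d \in divisors n -> (n %/ d)%N \in divisors n.
    by rewrite -!dvdn_divisors // => /dvdn_div.
  move=> d; apply/idP/mapP => [dn|[e en ->]]; last exact: dvd.
  by exists (n %/ d)%N; rewrite ?divK ?dvd.
by rewrite big_map; apply: eq_big_seq => d dn; rewrite divK // mulrC.
Qed.

Lemma dirichlet_conv_coprime (R : realType) (f g : arithmetic_function R)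
    (a b : nat) :
  multiplicative_arith f -> (0 < a)%N -> (0 < b)%N -> coprime a b ->
  dirichlet_conv f g (a * b)%N =
  \sum_(d <- divisors a) \sum_(e <- divisors b)
     f d * f e * g ((a %/ d) * (b %/ e))%N.
Proof.
move=> fM a0 b0 ab; rewrite /dirichlet_conv big_divisors_coprime //.
apply: eq_big_seq => d; rewrite -dvdn_divisors // => da.
apply: eq_big_seq => e; rewrite -dvdn_divisors // => eb.
have de : coprime d e by apply: coprime_dvdl da _; exact: coprime_dvdr eb _.
rewrite fM ?(dvdn_gt0 a0 da) ?(dvdn_gt0 b0 eb) //.
by rewrite divnMA -divn_mulAC // muln_divA.
Qed.

Lemma dirichlet_conv_Id_coprime (R : realType) (f : arithmetic_function R)
    (a b : nat) :
  multiplicative_arith f -> (0 < a)%N -> (0 < b)%N -> coprime a b ->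
  dirichlet_conv f (@arith_Id R) (a * b)%N =
  dirichlet_conv f (@arith_Id R) a * dirichlet_conv f (@arith_Id R) b.
Proof.
move=> fM a0 b0 ab; rewrite dirichlet_conv_coprime // big_distrl /=.
apply: eq_bigr => d _; rewrite big_distrr /=; apply: eq_bigr => e _.
by rewrite /arith_Id natrM mulrACA.
Qed.

(** The Leibniz rule for [delta] splits each term of the double sum over
divisors into two terms in which the variables are separated. *)
Lemma dirichlet_conv_delta_coprime (R : realType) (f : arithmetic_function R)
    (a b : nat) :
  multiplicative_arith f -> (0 < a)%N -> (0 < b)%N -> coprime a b ->
  dirichlet_conv f (@arith_delta R) (a * b)%N =
  dirichlet_conv f (@arith_delta R) a * dirichlet_conv f (@arith_Id R) b +
  dirichlet_conv f (@arith_Id R) a * dirichlet_conv f (@arith_delta R) b.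
Proof.
move=> fM a0 b0 ab; rewrite dirichlet_conv_coprime // !big_distrl /=.
rewrite -big_split /=; apply: eq_big_seq => d; rewrite -dvdn_divisors // => da.
rewrite !big_distrr -big_split /=.
apply: eq_big_seq => e; rewrite -dvdn_divisors // => eb.
have quo_gt0 m k : (0 < m)%N -> (k %| m)%N -> (0 < m %/ k)%N.
  by move=> m0 km; apply: (dvdn_gt0 m0); exact: dvdn_div.
rewrite /arith_delta /arith_Id.
rewrite (arith_deriv_leibniz (quo_gt0 _ _ a0 da) (quo_gt0 _ _ b0 eb)).
by rewrite natrD !natrM mulrDr; congr (_ + _); rewrite mulrACA.
Qed.

Lemma coprime_prodr (I : eqType) (r : seq I) (q : I -> nat) (a : nat) :
  {in r, forall i, coprime a (q i)} -> coprime a (\prod_(i <- r) q i).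
Proof.
move=> aq; rewrite big_seq; elim/big_rec: _ => [|i x ir ax]; first exact: coprimen1.
by rewrite coprimeMr aq.
Qed.

Lemma dirichlet_conv_delta_prod (R : realType) (f : arithmetic_function R)
    (I : eqType) (r : seq I) (q : I -> nat) :
  multiplicative_arith f -> uniq r ->
  (forall i, (0 < q i)%N) -> (forall i j, i != j -> coprime (q i) (q j)) ->
  (forall i, dirichlet_conv f (@arith_Id R) (q i) != 0) ->
  dirichlet_conv f (@arith_delta R) (\prod_(i <- r) q i)%N =
  dirichlet_conv f (@arith_Id R) (\prod_(i <- r) q i)%N *
    \sum_(i <- r) (dirichlet_conv f (@arith_delta R) (q i) /
                   dirichlet_conv f (@arith_Id R) (q i)).
Proof.
move=> fM + q_gt0 q_co E_neq0; elim: r => [|i r IHr] /=.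
  (* The empty product is [1], whose only divisor is [1], and [delta 1 = 0]. *)
  by rewrite !big_nil /dirichlet_conv big_seq1 /arith_delta /arith_deriv big_nil !mulr0.
case/andP=> ir r_uniq; rewrite !big_cons.
have co : coprime (q i) (\prod_(j <- r) q j).
  by apply: coprime_prodr => j jr; apply: q_co; apply: contraNneq ir => ->.
have prod_gt0 : (0 < \prod_(j <- r) q j)%N by exact: prodn_gt0.
rewrite dirichlet_conv_delta_coprime // dirichlet_conv_Id_coprime // IHr //.
rewrite mulrDr; congr (_ + _); last by rewrite mulrA.
by rewrite mulrAC mulrCA divff // mulr1 mulrC.
Qed.

Theorem lemma5 (R : realType) (f : arithmetic_function R)
    (hf : multiplicative_arith f)
    (n s : nat) (p alpha : 'I_s -> nat)
    (p_prime : forall i, prime (p i))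
    (p_inj : injective p)
    (alpha_ge1 : forall i, (1 <= alpha i)%N)
    (n_fact : n = (\prod_(i < s) p i ^ alpha i)%N)
    (den_neq0 : forall i,
      dirichlet_conv (@arith_Id R) f (p i ^ alpha i)%N != 0) :
  dirichlet_conv f (@arith_delta R) n =
    dirichlet_conv (@arith_Id R) f n *
      \sum_(i < s)
        (dirichlet_conv f (@arith_delta R) (p i ^ alpha i)%N /
         dirichlet_conv (@arith_Id R) f (p i ^ alpha i)%N).
Proof.
have q_gt0 i : (0 < p i ^ alpha i)%N by rewrite expn_gt0 prime_gt0.
have q_co i j : i != j -> coprime (p i ^ alpha i) (p j ^ alpha j).
  move=> ij; apply/coprimeXl/coprimeXr; rewrite prime_coprime //.
  by rewrite dvdn_prime2 // (inj_eq p_inj).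
have n_gt0 : (0 < n)%N by rewrite n_fact; exact: prodn_gt0.
rewrite (dirichlet_convC R (@arith_Id R)) //.
under eq_bigr => i _ do rewrite (dirichlet_convC R (@arith_Id R)) //.
rewrite n_fact.
apply: (@dirichlet_conv_delta_prod R f _ _ (fun i => p i ^ alpha i)%N) => // [|i].
  exact: index_enum_uniq.
by rewrite dirichlet_convC.
Qed.
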